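(* Assume that $X$ and $Y$ are Banach spaces such that $(X,Y)$ and $(Y,X)$ have the $\mu$-Lipschitz representation property for some $\mu\ge 1$. Then for any $f\in\mathcal{CLE}(X,Y)$, there exists $\varepsilon>0$ such that $f-u\in\mathcal{CLE}(X,Y)$ whenever $u:X\to Y$ is such that $Lip_\infty(u)<\varepsilon$.
   Context: For a map $f$ between Banach spaces, set $Lip_s(f)=\sup\{\|f(x)-f(x')\|/\|x-x'\| : \|x-x'\|\ge s\}$ for $s>0$ and $Lip_\infty(f)=\inf_{s>0}Lip_s(f)$; $f$ is coarse Lipschitz if $Lip_\infty(f)<\infty$, and $\mathcal{CL}(X,Y)$ is the set of coarse Lipschitz maps from $X$ to $Y$. A coarse Lipschitz map $f:X\to Y$ is a coarse Lipschitz equivalence if there exist a coarse Lipschitz map $g:Y\to X$ and a constant $C\ge0$ such that $\|(g\circ f)(x)-x\|\le C$ for all $x\in X$ and $\|(f\circ g)(y)-y\|\le C$ for all $y\in Y$. The set of such maps is denoted $\mathcal{CLE}(X,Y)$. $Lip_0(X,Y)$ is the space of Lipschitz functions from $X$ to $Y$ vanishing at $0$, and $Lip(g)$ is the Lipschitz constant of $g$. For $\mu\ge1$, the pair $(X,Y)$ has the $\mu$-Lipschitz representation property ($\mu$-LRP) if for any $f\in\mathcal{CL}(X,Y)$ and any $c>Lip_\infty(f)$ there exists $g\in Lip_0(X,Y)$ such that $Lip(g)<\mu c$ and $f-g$ is bounded. *)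

(* Defs.v *)
From HB Require Import structures.
From mathcomp Require Import all_boot all_order all_algebra.
From mathcomp Require Import all_classical all_reals all_analysis.

Set Implicit Arguments.
Unset Strict Implicit.
Unset Printing Implicit Defensive.

Import Order.TTheory GRing.Theory Num.Theory.
Import numFieldNormedType.Exports.

Local Open Scope classical_set_scope.
Local Open Scope ring_scope.

Section CoarseLipschitz.
Context {R : realType}.
Implicit Types X Y : completeNormedModType R.

(* The suprema below are taken in [0, +oo]: adjoining 0 only matters when no
   pair of points qualifies (zero-dimensional X), where the supremum is 0,
   whereas ereal_sup set0 = -oo. *)

Definition Lip_at X Y (s : R) (f : X -> Y) : \bar R :=
  ereal_sup (0%E |`
    [set (`|f p.1 - f p.2| / `|p.1 - p.2|)%:E | p in
      [set p : X * X | s <= `|p.1 - p.2|]]).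

Definition Lip_infty X Y (f : X -> Y) : \bar R :=
  ereal_inf [set Lip_at s f | s in [set s : R | 0 < s]].

Definition Lip X Y (f : X -> Y) : \bar R :=
  ereal_sup (0%E |`
    [set (`|f p.1 - f p.2| / `|p.1 - p.2|)%:E | p in
      [set p : X * X | p.1 != p.2]]).

Definition CL X Y : set (X -> Y) := [set f | (Lip_infty f < +oo)%E].

Definition CLE X Y : set (X -> Y) :=
  [set f | CL f /\
    exists g : Y -> X, CL g /\
      exists C : R, [/\ 0 <= C,
        forall x, `|(g \o f) x - x| <= C &
        forall y, `|(f \o g) y - y| <= C]].

Definition Lip0 X Y : set (X -> Y) := [set g | lipschitz g /\ g 0 = 0].

Definition LRP (mu : R) X Y : Prop :=
  forall (f : X -> Y) (c : R), CL f -> (Lip_infty f < c%:E)%E ->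
    exists g : X -> Y,
      [/\ Lip0 g, (Lip g < (mu * c)%:E)%E & bounded_fun (f \- g)].

End CoarseLipschitz.

(* Main.v *)
Require Import Defs.
From mathcomp Require Import all_boot all_order all_algebra.
From mathcomp Require Import all_classical all_reals all_analysis.
From mathcomp Require Import ring lra.
Import Order.TTheory GRing.Theory Num.Theory.
Import numFieldNormedType.Exports.
Local Open Scope classical_set_scope.
Local Open Scope ring_scope.

(** Coarse Lipschitz equivalences only see maps up to bounded error, and the
    representation property replaces each coarse Lipschitz map by a Lipschitz
    one at bounded distance, with a constant controlled by its Lipschitz number
    at infinity.  So [f], its coarse inverse [g] and the perturbation [u] may be
    taken Lipschitz, with [g] of constant [L] and [u] of constant at most
    [1 / (2 L)] when [eps] is small ([exists_lipschitz_approx]).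

    To invert [f - u] coarsely at [y] one wants [f x = y + u x] up to a bounded
    error.  Applying [g], this becomes the honest fixed point equation
    [x = g (y + u x)], whose right-hand side is a contraction in [x] with ratio
    [1/2]; this is where completeness of [X] enters.  Its solution [h y] depends
    on [y] in a Lipschitz way, satisfies [f (h y) = y + u (h y)] up to the error
    of [f \o g], and recovers [x] from [f x - u x] because [x] itself solves the
    equation up to the error of [g \o f] ([lipschitz_coarse_inverse_sub]).
    Undoing the replacement costs another bounded error
    ([CLE_of_lipschitz_approx]). *)

Section PerturbationOfEquivalences.
Context {R : realType}.
Implicit Types X Y : completeNormedModType R.

Lemma ltr_distB_lipschitz {X Y} {g : X -> Y} {k : R} :
  (Lip g < k%:E)%E -> forall x x', `|g x - g x'| <= k * `|x - x'|.
Proof.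
move=> gk x x'; have [->|xx'] := eqVneq x x'.
  by rewrite !subrr !normr0 mulr0.
rewrite -ler_pdivrMr ?normr_gt0 ?subr_eq0// -lee_fin.
by apply: le_trans (ltW gk); apply: ereal_sup_ubound; right; exists (x, x').
Qed.

Lemma CL_affine {X Y} {f : X -> Y} {A B : R} : 0 <= A -> 0 <= B ->
  (forall x x', `|f x - f x'| <= A * `|x - x'| + B) -> CL f.
Proof.
move=> A0 B0 fAB; apply: (@le_lt_trans _ _ (A + B)%:E); last exact: ltry.
(* At distance at least 1 the additive constant is absorbed in the slope. *)
apply: (@le_trans _ _ (Lip_at 1 f)).
  by apply: ereal_inf_lbound; exists 1 => //=.
apply: ge_ereal_sup => _ [->|[[x x'] /= xx' <-]].
  by rewrite lee_fin addr_ge0.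
have d0 : 0 < `|x - x'| by apply: lt_le_trans xx'.
rewrite lee_fin ler_pdivrMr// mulrDl (le_trans (fAB x x'))// lerD2l.
by rewrite ler_peMr.
Qed.

Lemma Lip_infty_ge0 {X Y} (f : X -> Y) : (0 <= Lip_infty f)%E.
Proof.
apply: le_ereal_inf_tmp => _ [s _ <-]; apply: ereal_sup_ubound; by left.
Qed.

Lemma CL_lt {X Y} {f : X -> Y} :
  CL f -> exists2 c : R, 0 < c & (Lip_infty f < c%:E)%E.
Proof.
rewrite /CL /=; have := Lip_infty_ge0 f.
case: (Lip_infty f) => [r| |] // r0 _.
by exists (r + 1); rewrite ?lte_fin ?ltrDl// ltr_wpDl.
Qed.

Lemma exists_lipschitz_approx {X Y} {mu : R} {f : X -> Y} {c : R} :
  LRP mu X Y -> (Lip_infty f < c%:E)%E ->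
  exists (g : X -> Y) (B : R),
    [/\ forall x x', `|g x - g x'| <= mu * c * `|x - x'|,
        0 <= B & forall x, `|f x - g x| <= B].
Proof.
move=> lrp fc; have clf : CL f by apply: lt_trans fc (ltry _).
have [g [_ gc fg]] := lrp f c clf fc.
have [B B0 fgB] := pinfty_ex_gt0 fg.
exists g, B; split; [exact: ltr_distB_lipschitz|exact: ltW|].
by move=> x; exact: fgB.
Qed.

Lemma lipschitz_fixed_point {X} {phi : X -> X} {q : R} : 0 <= q < 1 ->
  (forall x x', `|phi x - phi x'| <= q * `|x - x'|) -> exists p, p = phi p.
Proof.
move=> /andP[q0 q1] phiq.
have [|||p _ pE] := @banach_fixed_point R X setT [fun of totalfun phi].
- by exists (NngNum q0); split=> //= -[x x'] _; exact: phiq.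
- exact: closedT.
- by exists 0.
- by exists p.
Qed.

(** The inverse [h] solves [h y = g (y + v (h y))]; the constants are those of
    a contraction of ratio [1/2], for which an approximate solution with error
    [e] lies within [2 e] of the exact one. *)
Lemma lipschitz_coarse_inverse_sub {X Y} {f : X -> Y} {g : Y -> X}
    {v : X -> Y} {L M C : R} :
  0 <= L -> 0 <= M -> L * M <= 2^-1 ->
  (forall y y', `|g y - g y'| <= L * `|y - y'|) ->
  (forall x x', `|v x - v x'| <= M * `|x - x'|) ->
  (forall x, `|g (f x) - x| <= C) -> (forall y, `|f (g y) - y| <= C) ->
  exists h : Y -> X,
    [/\ forall y y', `|h y - h y'| <= 2 * L * `|y - y'|,
        forall x, `|h (f x - v x) - x| <= 2 * C &
        forall y, `|f (h y) - v (h y) - y| <= C].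
Proof.
move=> L0 M0 LM gL vM gf fg.
have gv a b x x' : `|g (a + v x) - g (b + v x')| <=
    L * `|a - b| + 2^-1 * `|x - x'|.
  apply: (le_trans (gL _ _)); rewrite opprD addrACA.
  apply: (@le_trans _ _ (L * (`|a - b| + M * `|x - x'|))).
    by rewrite ler_wpM2l// (le_trans (ler_normD _ _))// lerD2l.
  by rewrite mulrDr lerD2l mulrA ler_wpM2r.
have fixed y : exists x, x = g (y + v x).
  apply: (@lipschitz_fixed_point _ _ 2^-1) => [|x x'].
    by rewrite invr_ge0 ler0n invf_lt1 ?ltr1n ?ltr0n.
  by have := gv y y x x'; rewrite subrr normr0 mulr0 add0r.
have [h hE] := choice fixed.
exists h; split=> [y y'|x|y].
- have := gv y y' (h y) (h y'); rewrite -!hE; lra.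
- set z := h _.
  have zfx : `|z - g (f x)| <= 2^-1 * `|z - x|.
    have := gv (f x - v x) (f x - v x) z x.
    by rewrite subrr normr0 mulr0 add0r -hE subrK.
  have := ler_distD (g (f x)) z x; have := gf x; lra.
- by have := fg (y + v (h y)); rewrite -hE opprD addrA addrAC.
Qed.

Lemma CLE_of_lipschitz_approx {X Y} {F G : X -> Y} {h : Y -> X}
    {A B C D : R} : 0 <= A -> 0 <= B ->
  (forall x x', `|G x - G x'| <= A * `|x - x'|) ->
  (forall y y', `|h y - h y'| <= B * `|y - y'|) ->
  (forall x, `|F x - G x| <= D) ->
  (forall x, `|h (G x) - x| <= C) -> (forall y, `|G (h y) - y| <= C) ->
  CLE F.
Proof.
move=> A0 B0 GA hB FG hG Gh.
have D0 : 0 <= D := le_trans (normr_ge0 _) (FG 0).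
have C0 : 0 <= C := le_trans (normr_ge0 _) (hG 0).
split.
  apply: (@CL_affine _ _ _ A (D + D)) => // [|x x']; first exact: addr_ge0.
  have := ler_distD (G x) (F x) (F x'); have := ler_distD (G x') (G x) (F x').
  have := FG x; have := FG x'; rewrite (distrC (F x')); have := GA x x'; lra.
exists h; split.
  by apply: (@CL_affine _ _ _ B 0) => // y y'; rewrite addr0.
exists (B * D + D + C); have BD0 : 0 <= B * D by rewrite mulr_ge0.
split=> [|x|y] /=; first by rewrite !addr_ge0.
- have := ler_distD (h (G x)) (h (F x)) x; have := hG x.
  have := hB (F x) (G x); have := ler_wpM2l B0 (FG x); lra.
- have := ler_distD (G (h y)) (F (h y)) y; have := Gh y.
  have := FG (h y); lra.
Qed.

End PerturbationOfEquivalences.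

Theorem proposition4p6 (R : realType) (X Y : completeNormedModType R) (mu : R)
    (hmu : 1 <= mu) (hXY : LRP mu X Y) (hYX : LRP mu Y X)
    (f : X -> Y) (hf : CLE f) :
  exists eps : R, 0 < eps /\
    forall u : X -> Y, (Lip_infty u < eps%:E)%E -> CLE (f \- u).
Proof.
have mu0 : 0 < mu by apply: lt_le_trans hmu.
have [clf [g [clg [C [C0 /= gf fg]]]]] := hf.
have [cf cf0 fcf] := CL_lt clf; have [cg cg0 gcg] := CL_lt clg.
have [f1 [Bf [f1K Bf0 ff1]]] := exists_lipschitz_approx hXY fcf.
have [g1 [Bg [g1L Bg0 gg1]]] := exists_lipschitz_approx hYX gcg.
set K := mu * cf in f1K; set L := mu * cg in g1L.
have K0 : 0 < K by rewrite mulr_gt0.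
have L0 : 0 < L by rewrite mulr_gt0.
(* Chosen so that the Lipschitz representative of [u], of constant [mu * eps],
   satisfies [L * (mu * eps) = 1/2]. *)
pose eps := (2 * L * mu)^-1.
have eps0 : 0 < eps by rewrite invr_gt0 !mulr_gt0.
exists eps; split=> // u ueps.
have [v [Bu [vM Bu0 uv]]] := exists_lipschitz_approx hXY ueps.
have M0 : 0 < mu * eps by rewrite mulr_gt0.
have LM : L * (mu * eps) <= 2^-1.
  suff -> : L * (mu * eps) = 2^-1 by [].
  by rewrite /eps; field; rewrite !gt_eqF.
pose E := C + (L * Bf + Bg) + (K * Bg + Bf).
have KB0 : 0 <= K * Bg by rewrite mulr_ge0// ltW.
have LB0 : 0 <= L * Bf by rewrite mulr_ge0// ltW.
have g1f1 x : `|g1 (f1 x) - x| <= E.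
  have := ler_distD (g1 (f x)) (g1 (f1 x)) x.
  have := ler_distD (g (f x)) (g1 (f x)) x.
  have := g1L (f1 x) (f x); rewrite (distrC (f1 x)).
  have := ler_wpM2l (ltW L0) (ff1 x).
  have := gg1 (f x); rewrite (distrC (g (f x)) (g1 _)).
  have := gf x; rewrite /E; lra.
have f1g1 y : `|f1 (g1 y) - y| <= E.
  have := ler_distD (f1 (g y)) (f1 (g1 y)) y.
  have := ler_distD (f (g y)) (f1 (g y)) y.
  have := f1K (g1 y) (g y); rewrite (distrC (g1 y)).
  have := ler_wpM2l (ltW K0) (gg1 y).
  have := ff1 (g y); rewrite (distrC (f (g y)) (f1 _)).
  have := fg y; rewrite /E; lra.
have [h [hL hF Fh]] :=
  lipschitz_coarse_inverse_sub (ltW L0) (ltW M0) LM g1L vM g1f1 f1g1.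
have E0 : 0 <= E := le_trans (normr_ge0 _) (g1f1 0).
apply: (@CLE_of_lipschitz_approx _ _ _ _ (f1 \- v) h
  (K + mu * eps) (2 * L) (2 * E) (Bf + Bu)) => //=.
- by rewrite addr_ge0// ltW.
- by rewrite mulr_ge0// ltW.
- move=> x x'; rewrite opprD addrACA -opprD.
  by rewrite (le_trans (ler_normB _ _))// mulrDl lerD.
- move=> x; rewrite opprD addrACA -opprD.
  by rewrite (le_trans (ler_normB _ _))// lerD.
- by move=> y; apply: (le_trans (Fh y)); lra.
Qed.
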